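(* Let $D\subsetneq\mathbb{R}^n$ be any domain with $\partial D\ne\emptyset$. (1) For all $x,y\in D$, $$2\tilde\tau_D(x,y)\le u_D(x,y),$$ and equality holds whenever $d(x)=|x-p|=|y-p|=d(y)$ for some $p\in\partial D$. (2) If $D$ is not a once-punctured space, then there exists no constant $k\ge0$ such that $u_D(x,y)\le 2\tilde\tau_D(x,y)+k$ for all $x,y\in D$. (3) If $D$ is a once-punctured space, then for all $x,y\in D$, $$u_D(x,y)\le 2\tilde\tau_D(x,y)+2\log2,$$ and this inequality is sharp, i.e. the additive constant $2\log 2$ cannot be replaced by a smaller one.
   Context: Here $n\ge2$, a domain is an open connected set, and a once-punctured space is a set of the form $\mathbb{R}^n\setminus\{p\}$ with $p\in\mathbb{R}^n$. The boundary $\partial D$ is taken in $\mathbb{R}^n$ and $d(x)=\mathrm{dist}(x,\partial D)$. For $x,y\in D$, $$\tilde\tau_D(x,y)=\log\left(1+\sup_{p\in\partial D}\frac{|x-y|}{\sqrt{|x-p||p-y|}}\right),\qquad u_D(x,y)=2\log\frac{|x-y|+\max\{d(x),d(y)\}}{\sqrt{d(x)d(y)}}.$$ *)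

(* Defs.v *)
From mathcomp Require Import all_boot all_order all_algebra.
From mathcomp Require Import all_classical all_reals all_analysis.

Set Implicit Arguments.
Unset Strict Implicit.
Unset Printing Implicit Defensive.

Import Order.TTheory GRing.Theory Num.Theory.
Import numFieldNormedType.Exports.

Local Open Scope classical_set_scope.
Local Open Scope ring_scope.

(* The library norm `|x| on 'rV[R]_n is the sup norm, so the Euclidean norm has
   to be defined. Both norms induce the same topology, hence the library's
   open, connected, closure and interior on 'rV[R]_n are the usual ones. *)
Definition enorm (R : realType) (n : nat) (x : 'rV[R]_n) : R :=
  Num.sqrt (\sum_(i < n) x ord0 i ^+ 2).

Definition domain (R : realType) (n : nat) (D : set 'rV[R]_n) : Prop :=
  open D /\ connected D.

Definition boundary (R : realType) (n : nat) (D : set 'rV[R]_n) :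
  set 'rV[R]_n := closure D `\` interior D.

Definition once_punctured (R : realType) (n : nat) (D : set 'rV[R]_n) : Prop :=
  exists p : 'rV[R]_n, D = ~` [set p].

(* The infimum and the supremum below are taken in R, where inf and sup are 0
   for empty or unbounded sets. When D is open with a nonempty boundary and
   x, y \in D, both sets are nonempty and bounded (the second one by
   enorm (x - y) / sqrt (d(x) d(y))), so the values are the genuine ones. *)
Definition bdist (R : realType) (n : nat) (D : set 'rV[R]_n) (x : 'rV[R]_n) :
  R := inf [set enorm (x - p) | p in boundary D].

Definition tautilde (R : realType) (n : nat) (D : set 'rV[R]_n)
    (x y : 'rV[R]_n) : R :=
  ln (1 + sup [set enorm (x - y) / Num.sqrt (enorm (x - p) * enorm (p - y))
              | p in boundary D]).

Definition umetric (R : realType) (n : nat) (D : set 'rV[R]_n)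
    (x y : 'rV[R]_n) : R :=
  2 * ln ((enorm (x - y) + Num.max (bdist D x) (bdist D y))
          / Num.sqrt (bdist D x * bdist D y)).

(* Main.v *)
(* Write A = |x - y|, s = sqrt (d(x) d(y)), M = max (d(x), d(y)), and S for the
   supremum defining tau. Exponentiating, u <= 2 tau + k says
   (A + M) / s <= exp (k / 2) (1 + S). Part (1) follows from S <= A / s and
   s <= M. For (2), an open set with two boundary points p, q contains x near p
   and y near q; then A / s grows like 1 / s while S is of smaller order. A
   domain with a single boundary point is once-punctured since n >= 2. For (3),
   S = A / s and M <= A + s. *)
Require Import Defs.
From mathcomp Require Import all_boot all_order all_algebra.
From mathcomp Require Import all_classical all_reals all_analysis.
From mathcomp Require Import ring lra.

Import Order.TTheory GRing.Theory Num.Theory.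
Import numFieldNormedType.Exports.

Local Open Scope classical_set_scope.
Local Open Scope ring_scope.

(** * The Euclidean norm and its comparison with the sup norm *)

Lemma enorm_ge0 {R : realType} {n : nat} (x : 'rV[R]_n) : 0 <= enorm x.
Proof. exact: sqrtr_ge0. Qed.

Lemma sqr_enorm {R : realType} {n : nat} (x : 'rV[R]_n) :
  enorm x ^+ 2 = \sum_(i < n) x ord0 i ^+ 2.
Proof. by rewrite sqr_sqrtr// sumr_ge0// => i _; rewrite sqr_ge0. Qed.

Lemma enormZ {R : realType} {n : nat} (a : R) (x : 'rV[R]_n) :
  enorm (a *: x) = `|a| * enorm x.
Proof.
rewrite /enorm -sqrtr_sqr -sqrtrM ?sqr_ge0// mulr_sumr; congr Num.sqrt.
by apply: eq_bigr => i _; rewrite mxE exprMn.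
Qed.

Lemma enorm_sub_sym {R : realType} {n : nat} (x y : 'rV[R]_n) :
  enorm (x - y) = enorm (y - x).
Proof. by rewrite -opprB -scaleN1r enormZ normrN1 mul1r. Qed.

Lemma coord_le_enorm {R : realType} {n : nat} (x : 'rV[R]_n) (i : 'I_n) :
  `|x ord0 i| <= enorm x.
Proof.
rewrite -sqrtr_sqr ler_wsqrtr// (bigD1 i)//= lerDl sumr_ge0// => j _.
by rewrite sqr_ge0.
Qed.

Lemma enorm_eq0 {R : realType} {n : nat} (x : 'rV[R]_n) :
  (enorm x == 0) = (x == 0).
Proof.
apply/eqP/eqP => [x0|->]; last by rewrite -(scale0r 0) enormZ normr0 mul0r.
apply/rowP => i; apply/eqP; rewrite !mxE -normr_le0 -x0.
exact: coord_le_enorm.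
Qed.

Lemma enorm_gt0 {R : realType} {n : nat} (x : 'rV[R]_n) :
  (0 < enorm x) = (x != 0).
Proof. by rewrite lt_def enorm_ge0 andbT enorm_eq0. Qed.

Lemma enorm_le_coord {R : realType} {n : nat} (x : 'rV[R]_n) (e : R) :
  0 <= e -> (forall i, `|x ord0 i| <= e) -> enorm x <= n%:R * e.
Proof.
move=> e0 xe; rewrite -(ler_pXn2r (n := 2))// ?nnegrE ?enorm_ge0 ?mulr_ge0//.
rewrite sqr_enorm; apply: (@le_trans _ _ (\sum_(i < n) e ^+ 2)).
  apply: ler_sum => i _.
  by rewrite -(real_normK (num_real (x ord0 i))) lerXn2r ?nnegrE.
rewrite sumr_const card_ord -[leLHS]mulr_natl exprMn ler_wpM2r ?sqr_ge0//.
by rewrite -natrX ler_nat; case: n {x xe} => // n; rewrite leq_pmulr.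
Qed.

(** Cauchy-Schwarz: the sum of squares of [enorm y * x_i - enorm x * y_i] expands to 2 |x| |y| (|x|
    |y| - x.y). Zero vectors are split off first so that |x| |y| can be cancelled. *)
Lemma dot_le_enorm {R : realType} {n : nat} (x y : 'rV[R]_n) :
  \sum_(i < n) x ord0 i * y ord0 i <= enorm x * enorm y.
Proof.
have [/eqP|x0] := eqVneq (enorm x) 0.
  rewrite enorm_eq0 => /eqP ->; rewrite big1 ?mulr_ge0 ?enorm_ge0// => i _.
  by rewrite mxE mul0r.
have [/eqP|y0] := eqVneq (enorm y) 0.
  rewrite enorm_eq0 => /eqP ->; rewrite big1 ?mulr_ge0 ?enorm_ge0// => i _.
  by rewrite mxE mulr0.
have ab : 0 < enorm x * enorm y by rewrite mulr_gt0// lt_def ?x0 ?y0 enorm_ge0.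
have : 0 <= \sum_(i < n) (enorm y * x ord0 i - enorm x * y ord0 i) ^+ 2.
  by rewrite sumr_ge0// => i _; rewrite sqr_ge0.
rewrite (eq_bigr (fun i => enorm y ^+ 2 * x ord0 i ^+ 2 +
  enorm x ^+ 2 * y ord0 i ^+ 2 -
  2 * (enorm x * enorm y) * (x ord0 i * y ord0 i))); last by move=> i _; ring.
rewrite sumrB big_split/= -!mulr_sumr -!sqr_enorm => H.
rewrite -(ler_pM2l ab); lra.
Qed.

Lemma ler_enormD {R : realType} {n : nat} (x y : 'rV[R]_n) :
  enorm (x + y) <= enorm x + enorm y.
Proof.
rewrite -(ler_pXn2r (n := 2))// ?nnegrE ?addr_ge0 ?enorm_ge0//.
rewrite sqrrD !sqr_enorm.
rewrite (eq_bigr (fun i => x ord0 i ^+ 2 + y ord0 i ^+ 2 +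
  2 * (x ord0 i * y ord0 i))); last by move=> i _; rewrite mxE; ring.
rewrite !big_split/= -mulr_sumr; have := dot_le_enorm x y; lra.
Qed.

Lemma enorm_triangle {R : realType} {n : nat} (p x y : 'rV[R]_n) :
  enorm (x - y) <= enorm (x - p) + enorm (p - y).
Proof. by rewrite -{1}(subrK p x) -addrA ler_enormD. Qed.

(** * Boundary points and the distance to the boundary *)

Lemma boundary_not_in {R : realType} {n : nat} (D : set 'rV[R]_n) p :
  open D -> boundary D p -> ~ D p.
Proof. by move=> oD [_ nDp] Dp; apply: nDp; exact: open_nbhs_nbhs. Qed.

Lemma boundary_approx {R : realType} {n : nat} (D : set 'rV[R]_n) p (e : R) :
  boundary D p -> 0 < e -> exists2 x, D x & enorm (x - p) < e.
Proof.
move=> [Dp _] e0; have n0 : 0 < n.+1%:R :> R by [].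
(* The ball is a sup-norm ball, and passing to [enorm] costs a factor n; dividing by n + 1 keeps the
   final bound strict and covers n = 0. *)
have d0 : 0 < e / n.+1%:R by rewrite divr_gt0.
have [x [Dx [_ px]]] := Dp _ (nbhsx_ballx p _ d0).
exists x => //; rewrite enorm_sub_sym.
apply: (@le_lt_trans _ _ (n%:R * (e / n.+1%:R))).
  by apply: enorm_le_coord (ltW d0) _ => i; rewrite !mxE; exact/ltW/px.
by rewrite mulrA ltr_pdivrMr// mulrC ltr_pM2l// ltr_nat.
Qed.

Lemma bdist_le {R : realType} {n : nat} (D : set 'rV[R]_n) x p :
  boundary D p -> bdist D x <= enorm (x - p).
Proof.
move=> Dp; apply: ge_inf; last by exists p.
by exists 0 => _ [q _ <-]; exact: enorm_ge0.
Qed.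

(** A sup-norm ball of radius e around x inside D contains the Euclidean one, so no boundary point
    is closer to x than e. *)
Lemma bdist_gt0 {R : realType} {n : nat} (D : set 'rV[R]_n) x :
  open D -> boundary D !=set0 -> D x -> 0 < bdist D x.
Proof.
move=> oD [p Dp] Dx.
have /nbhs_ballP[e /= e0 xeD] : nbhs x D by exact: open_nbhs_nbhs.
apply: (lt_le_trans e0); apply: lb_le_inf; first by exists (enorm (x - p)), p.
move=> _ [q Dq <-]; rewrite leNgt; apply/negP => xq.
apply: (boundary_not_in D q oD Dq); apply: xeD; split=> // i j.
rewrite [i]ord1; apply: le_lt_trans xq.
by have := coord_le_enorm (x - q) j; rewrite !mxE.
Qed.

(** * Open sets with exactly one boundary point *)

Lemma segment_continuous {R : realType} {n : nat} (x z : 'rV[R]_n) :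
  continuous (fun t : R => x + t *: (z - x)).
Proof.
move=> t; apply: cvgD; first exact: cvg_cst.
exact: scalel_continuous.
Qed.

(** If the segment missed the boundary, D and its closure would have the same trace on it, so the
    parameters landing in D would form a nonempty clopen subset of [0, 1], forcing z into D. *)
Lemma segment_boundary {R : realType} {n : nat} (D : set 'rV[R]_n) x z :
  open D -> D x -> ~ D z ->
  exists2 t : R, 0 <= t <= 1 & boundary D (x + t *: (z - x)).
Proof.
move=> oD Dx nDz; apply: contrapT => nb; apply: nDz.
pose f (t : R) := x + t *: (z - x).
have cf : continuous f by exact: segment_continuous.
have f1 : f 1 = z by rewrite /f scale1r addrC subrK.
have E : `[0, 1] `&` f @^-1` D = `[0 : R, 1]%classic.
  apply: (@segment_connected R 0 1).
  - by exists 0; split; rewrite /= ?in_itv/= ?lexx ?ler01// /f scale0r addr0.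
  - by exists (f @^-1` D) => //; move/continuousP: cf; apply.
  - exists (f @^-1` closure D).
      by move/continuous_closedP: cf; apply; exact: closed_closure.
    rewrite eqEsubset; split=> t [t01 Dt]; split=> //.
      exact: subset_closure.
    apply: contrapT => nDt; apply: nb; exists t.
      by move: t01; rewrite /= in_itv.
    by split => // /interior_subset.
have : `[0 : R, 1]%classic 1 by rewrite /= in_itv/= ler01 lexx.
by rewrite -E => -[_]; rewrite /= f1.
Qed.

(* A point z <> p outside D is reached from D by a segment, or by two segments
   through a point w off the line, avoiding p; such a path crosses the
   boundary. *)
Lemma boundary1_punctured {R : realType} {n : nat} (D : set 'rV[R]_n) p :
  (2 <= n)%N -> open D -> boundary D = [set p] -> D = ~` [set p].
Proof.
move=> n2 oD bD; have bp : boundary D p by rewrite bD.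
have nDp := boundary_not_in D p oD bp.
rewrite eqEsubset; split=> [z Dz zp|z /= zp]; first by rewrite zp in Dz.
apply: contrapT => nDz.
(* A crossing point can only be p, which gives one equation per coordinate. *)
have cross u v : D u -> ~ D v ->
    exists t : R, forall k, u ord0 k + t * (v ord0 k - u ord0 k) = p ord0 k.
  move=> Du nDv; have [t _] := segment_boundary D u v oD Du nDv.
  by rewrite bD => <-; exists t => k; rewrite !mxE.
have [x Dx _] := boundary_approx D p 1 bp ltr01.
have [i xi] : exists i, x ord0 i != p ord0 i.
  apply: contrapT => xp; apply: nDp; suff <- : x = p by [].
  by apply/rowP => i; apply: contrapT => /eqP xi; apply: xp; exists i.
have [j ji] : exists j : 'I_n, j != i.
  have [->|i0] := eqVneq i (Ordinal (ltnW n2)).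
    by exists (Ordinal n2).
  by exists (Ordinal (ltnW n2)); rewrite eq_sym.
(* w agrees with p in coordinate i, where x does not, and differs from p in coordinate j; hence p is
   not on the segment from x to w. *)
pose w : 'rV[R]_n := p + delta_mx ord0 j.
have wi : w ord0 i = p ord0 i by rewrite !mxE [i == j]eq_sym (negbTE ji) addr0.
have wj : w ord0 j = p ord0 j + 1 by rewrite !mxE !eqxx.
have xi0 : x ord0 i - p ord0 i != 0 by rewrite subr_eq0.
have [Dw|nDw] := pselect (D w).
(* Coordinate j gives s <> 0, so coordinate i of the first crossing gives z_i = p_i; coordinate i of
   the second then forces t = 1, that is z = p. *)
- have [s Hs] := cross _ _ Dw nDz; have [t Ht] := cross _ _ Dx nDz.
  have s0 : s != 0.
    apply/eqP => s0; have := Hs j; rewrite wj s0 mul0r addr0 => /eqP.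
    by rewrite -subr_eq0 addrAC subrr add0r oner_eq0.
  have zi : z ord0 i = p ord0 i.
    apply: (mulfI s0); have := Hs i; rewrite wi; lra.
  have t1 : t = 1.
    apply: (mulIf xi0); have := Ht i; rewrite zi; lra.
  by apply: zp; apply/rowP => k; have := Ht k; rewrite t1; lra.
- have [t Ht] := cross _ _ Dx nDw.
  have t1 : t = 1.
    apply: (mulIf xi0); have := Ht i; rewrite wi; lra.
  by have := Ht j; rewrite t1 wj; lra.
Qed.

Lemma boundary_punctured {R : realType} {n : nat} (D : set 'rV[R]_n) p :
  open D -> boundary D !=set0 -> D = ~` [set p] -> boundary D = [set p].
Proof.
move=> oD [q Dq] DE.
have sub : boundary D `<=` [set p].
  move=> r Dr; apply: contrapT => rp; apply: (boundary_not_in D r oD Dr).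
  by rewrite DE.
by rewrite eqEsubset; split=> // r ->; rewrite -(sub _ Dq).
Qed.

Lemma two_boundary_points {R : realType} {n : nat} (D : set 'rV[R]_n) :
  (2 <= n)%N -> open D -> boundary D !=set0 -> ~ once_punctured D ->
  exists p q, [/\ boundary D p, boundary D q & p != q].
Proof.
move=> n2 oD [p Dp] nop; apply: contrapT => H; apply: nop; exists p.
apply: boundary1_punctured => //; rewrite eqEsubset; split=> [q Dq|_ ->//].
apply: contrapT => qp; apply: H; exists p, q; split=> //.
by apply/eqP => pq; apply: qp.
Qed.

(** * Comparison of the two functions with the logarithms removed *)

Definition tau_quot {R : realType} {n : nat} (x y p : 'rV[R]_n) : R :=
  enorm (x - y) / Num.sqrt (enorm (x - p) * enorm (p - y)).

Definition tau_sup {R : realType} {n : nat} (D : set 'rV[R]_n)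
    (x y : 'rV[R]_n) : R :=
  sup [set tau_quot x y p | p in boundary D].

Lemma tau_quot_ge0 {R : realType} {n : nat} (x y p : 'rV[R]_n) :
  0 <= tau_quot x y p.
Proof. by rewrite divr_ge0 ?enorm_ge0 ?sqrtr_ge0. Qed.

Section InDomain.
Context {R : realType} {n : nat} (D : set 'rV[R]_n).
Context (oD : open D) (bD : boundary D !=set0).

Lemma tau_sup_le (x y : 'rV[R]_n) (B : R) :
  (forall p, boundary D p -> tau_quot x y p <= B) -> tau_sup D x y <= B.
Proof.
move=> HB; have [p Dp] := bD; apply: ge_sup.
  by exists (tau_quot x y p), p.
by move=> _ [q Dq <-]; exact: HB.
Qed.

(** This bound, uniform in p, is also what makes the set under [tau_sup] bounded, hence its supremum
    genuine. *)
Lemma tau_quot_le (x y p : 'rV[R]_n) : D x -> D y -> boundary D p ->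
  tau_quot x y p <= enorm (x - y) / Num.sqrt (bdist D x * bdist D y).
Proof.
move=> Dx Dy Dp; have dx := bdist_gt0 D x oD bD Dx.
have dy := bdist_gt0 D y oD bD Dy.
have le : bdist D x * bdist D y <= enorm (x - p) * enorm (p - y).
  rewrite ler_pM ?(ltW dx) ?(ltW dy) ?bdist_le//.
  by rewrite enorm_sub_sym bdist_le.
have pp := mulr_gt0 dx dy.
rewrite ler_wpM2l ?enorm_ge0// lef_pV2 ?posrE ?sqrtr_gt0 ?(lt_le_trans pp le)//.
exact: ler_wsqrtr.
Qed.

Lemma tau_quot_le_sup (x y p : 'rV[R]_n) : D x -> D y -> boundary D p ->
  tau_quot x y p <= tau_sup D x y.
Proof.
move=> Dx Dy Dp; apply: ub_le_sup; last by exists p.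
exists (enorm (x - y) / Num.sqrt (bdist D x * bdist D y)).
by move=> _ [q Dq <-]; exact: tau_quot_le.
Qed.

Lemma tau_sup_ge0 (x y : 'rV[R]_n) : D x -> D y -> 0 <= tau_sup D x y.
Proof.
move=> Dx Dy; have [p Dp] := bD.
exact: le_trans (tau_quot_ge0 _ _ _) (tau_quot_le_sup _ _ _ Dx Dy Dp).
Qed.

Definition umetric_quot (x y : 'rV[R]_n) : R :=
  (enorm (x - y) + Num.max (bdist D x) (bdist D y))
  / Num.sqrt (bdist D x * bdist D y).

Lemma sqrt_bdist_gt0 (x y : 'rV[R]_n) : D x -> D y ->
  0 < Num.sqrt (bdist D x * bdist D y).
Proof. by move=> Dx Dy; rewrite sqrtr_gt0 mulr_gt0// bdist_gt0. Qed.

Lemma umetric_quot_gt0 (x y : 'rV[R]_n) : D x -> D y -> 0 < umetric_quot x y.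
Proof.
move=> Dx Dy; rewrite divr_gt0 ?sqrt_bdist_gt0//.
by rewrite ltr_wpDl ?enorm_ge0// lt_max bdist_gt0.
Qed.

Lemma sqrt_bdist_le_max (x y : 'rV[R]_n) : D x -> D y ->
  Num.sqrt (bdist D x * bdist D y) <= Num.max (bdist D x) (bdist D y).
Proof.
move=> Dx Dy; have dx := ltW (bdist_gt0 D x oD bD Dx).
have dy := ltW (bdist_gt0 D y oD bD Dy).
have m0 : 0 <= Num.max (bdist D x) (bdist D y) by rewrite le_max dx.
rewrite -(ger0_norm m0) -sqrtr_sqr ler_wsqrtr// expr2.
by rewrite ler_pM// le_max lexx ?orbT.
Qed.

Lemma tautilde_le_umetric (x y : 'rV[R]_n) : D x -> D y ->
  2 * tautilde D x y <= umetric D x y.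
Proof.
move=> Dx Dy; rewrite ler_pM2l// ler_ln ?posrE; last 2 first.
- by rewrite ltr_pwDl// tau_sup_ge0.
- exact: umetric_quot_gt0.
apply: le_trans (_ : 1 + enorm (x - y) / Num.sqrt (bdist D x * bdist D y) <= _).
  by rewrite lerD2l; apply: tau_sup_le => p; exact: tau_quot_le.
rewrite mulrDl addrC lerD2l ler_pdivlMr ?sqrt_bdist_gt0// mul1r.
exact: sqrt_bdist_le_max.
Qed.

(** With common distance d, s = M = d, and the term of p alone gives S >= A / d; both logarithms are
    then taken at 1 + A / d. *)
Lemma tautilde_eq_umetric (x y p : 'rV[R]_n) : D x -> D y -> boundary D p ->
  bdist D x = enorm (x - p) -> enorm (x - p) = enorm (y - p) ->
  enorm (y - p) = bdist D y -> 2 * tautilde D x y = umetric D x y.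
Proof.
move=> Dx Dy Dp dx xyp dy; apply/le_anti; rewrite tautilde_le_umetric//=.
have dxy : bdist D x = bdist D y by rewrite dx xyp.
have := sqrt_bdist_gt0 _ _ Dx Dy.
have := tau_quot_le_sup _ _ _ Dx Dy Dp.
rewrite /umetric ler_pM2l// ler_ln ?posrE ?umetric_quot_gt0//; last first.
  by rewrite ltr_pwDl// tau_sup_ge0.
rewrite /tau_quot [enorm (p - y)]enorm_sub_sym dy -dx dxy maxxx => Hp s0.
have s : Num.sqrt (bdist D y * bdist D y) = bdist D y.
  by rewrite -expr2 sqrtr_sqr ger0_norm// ltW// bdist_gt0.
rewrite s in Hp s0 *; rewrite mulrDl divff ?gt_eqF// addrC lerD2l.
exact: Hp.
Qed.

(** Stated as a boolean equality so that it rewrites both the upper bound and, through [ltNge], its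
    failure. *)
Lemma umetric_leD (x y : 'rV[R]_n) (k : R) : D x -> D y ->
  (umetric D x y <= 2 * tautilde D x y + k) =
  (umetric_quot x y <= expR (k / 2) * (1 + tau_sup D x y)).
Proof.
move=> Dx Dy; have t0 : 0 < 1 + tau_sup D x y.
  by rewrite ltr_pwDl// tau_sup_ge0.
rewrite -[RHS]ler_ln ?posrE ?umetric_quot_gt0 ?mulr_gt0 ?expR_gt0//.
rewrite lnM ?posrE ?expR_gt0// expRK /umetric /tautilde.
rewrite -[in RHS](ler_pM2l (ltr0Sn R 1)) mulrDr [2 * (k / 2)]mulrC.
by rewrite divfK ?pnatr_eq0// [in RHS]addrC.
Qed.

End InDomain.

(** * Two boundary points: no additive constant *)

(* Take x, y near distinct boundary points p, q, so that the boundary distances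
   are at most 2 h^2 |x - y| with h = 1 / (4 K), K = exp (k / 2). Every point r
   is at distance at least |x - y| / 2 from x or from y, which bounds the
   supremum by 2 h |x - y| / sqrt (d(x) d(y)). *)
Lemma umetric_not_le_tautildeD {R : realType} {n : nat} (D : set 'rV[R]_n)
    (p q : 'rV[R]_n) (k : R) :
  open D -> boundary D p -> boundary D q -> p != q -> 0 <= k ->
  exists x y, [/\ D x, D y & 2 * tautilde D x y + k < umetric D x y].
Proof.
move=> oD Dp Dq pq k0; have bD : boundary D !=set0 by exists p.
pose K := expR (k / 2); have K1 : 1 <= K by rewrite -expR0 ler_expR divr_ge0.
have K0 : 0 < K by rewrite expR_gt0.
pose h := (4 * K)^-1; have h0 : 0 < h by rewrite invr_gt0 mulr_gt0.
have hK : h * K = 4^-1 by rewrite /h; field; rewrite gt_eqF.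
have h4 : h <= 4^-1 by rewrite -hK ler_peMr// ltW.
pose L := enorm (p - q); have L0 : 0 < L by rewrite enorm_gt0 subr_eq0.
have e0 : 0 < h ^+ 2 * L by rewrite mulr_gt0// exprn_gt0.
have [x Dx xp] := boundary_approx D p _ Dp e0.
have [y Dy yq] := boundary_approx D q _ Dq e0.
exists x, y; split=> //; rewrite ltNge umetric_leD// -/K -ltNge.
set A := enorm (x - y).
have hh : h ^+ 2 <= 16^-1 by nra.
have eL : h ^+ 2 * L <= 16^-1 * L by rewrite ler_wpM2r// ltW.
(* By the triangle inequality, L <= A + 2 h^2 L <= A + L / 8. *)
have LA : L <= 2 * A.
  have := enorm_triangle x p q; have := enorm_triangle y x q.
  rewrite [enorm (p - x)]enorm_sub_sym -/L -/A; lra.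
have A0 : 0 < A by lra.
have small : h ^+ 2 * L <= 2 * h ^+ 2 * A.
  by rewrite -mulrA mulrCA ler_pM2l// exprn_gt0.
have dx : bdist D x <= 2 * h ^+ 2 * A.
  by apply: le_trans small; apply: le_trans (ltW xp); exact: bdist_le.
have dy : bdist D y <= 2 * h ^+ 2 * A.
  by apply: le_trans small; apply: le_trans (ltW yq); exact: bdist_le.
have dx0 := bdist_gt0 D x oD bD Dx; have dy0 := bdist_gt0 D y oD bD Dy.
set s := Num.sqrt (bdist D x * bdist D y).
have s0 : 0 < s by exact: sqrt_bdist_gt0.
have sm : s <= 2 * h ^+ 2 * A.
  by apply: (le_trans (sqrt_bdist_le_max D oD bD x y Dx Dy)); rewrite ge_max dx.
have h20 : 0 <= h ^+ 2 by rewrite sqr_ge0.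
have supB : tau_sup D x y <= 2 * h * A / s.
  apply: tau_sup_le => // r Dr; rewrite /tau_quot -/A.
  have xr := bdist_le D x r Dr; have yr := bdist_le D y r Dr.
  rewrite enorm_sub_sym in yr.
  have Ar := enorm_triangle r x y; rewrite -/A in Ar.
  set a := enorm (x - r) in xr Ar *; set b := enorm (r - y) in yr Ar *.
  have a0 : 0 < a by exact: lt_le_trans xr.
  have b0 : 0 < b by exact: lt_le_trans yr.
  (* The larger of a and b is at least A / 2, so the boundary distance on that side, at most 2 h^2
     A, is at most (2 h)^2 times it; the other side uses only [xr] or [yr]. *)
  have sab : s <= 2 * h * Num.sqrt (a * b).
    have -> : 2 * h = Num.sqrt ((2 * h) ^+ 2).
      by rewrite sqrtr_sqr ger0_norm ?mulr_ge0// ltW.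
    rewrite -sqrtrM ?sqr_ge0// ler_wsqrtr//.
    have [ab|ba] := leP a b.
      rewrite [_ * b]mulrC mulrA mulrC ler_pM ?(ltW dx0) ?(ltW dy0)//.
      apply: (le_trans dy); rewrite exprMn; nra.
    rewrite mulrA ler_pM ?(ltW dx0) ?(ltW dy0)//.
    apply: (le_trans dx); rewrite exprMn; nra.
  have t0 : 0 < Num.sqrt (a * b) by rewrite sqrtr_gt0 mulr_gt0.
  rewrite ler_pdivrMr// [leRHS]mulrAC ler_pdivlMr//.
  by rewrite [leRHS]mulrAC [leRHS]mulrC ler_wpM2l// ltW.
apply: (@le_lt_trans _ _ (K * (1 + 2 * h * A / s))).
  by rewrite ler_pM2l// lerD2l.
rewrite /umetric_quot -/A -/s ltr_pdivlMr//.
rewrite -[ltLHS]mulrA [_ * s]mulrDl mul1r divfK ?gt_eqF//.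
apply: (@le_lt_trans _ _ (K * (2 * h ^+ 2 * A + 2 * h * A))).
  by rewrite ler_pM2l// lerD2r.
(* Since h K = 1 / 4 and h <= 1 / 4, this equals (h + 1) A / 2 < A. *)
have -> : K * (2 * h ^+ 2 * A + 2 * h * A) = 2 * (h * K) * (h + 1) * A by ring.
rewrite hK; apply: (@lt_le_trans _ _ A).
  by rewrite gtr_pMl//; lra.
by rewrite lerDl le_max ltW.
Qed.

(** * Once-punctured spaces: the constant 2 log 2 and its sharpness *)

Lemma bdist_boundary1 {R : realType} {n : nat} (D : set 'rV[R]_n) x p :
  boundary D = [set p] -> bdist D x = enorm (x - p).
Proof. by move=> bD; rewrite /bdist bD image_set1 inf1. Qed.

Lemma tau_sup_boundary1 {R : realType} {n : nat} (D : set 'rV[R]_n) x y p :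
  boundary D = [set p] -> tau_sup D x y = tau_quot x y p.
Proof. by move=> bD; rewrite /tau_sup bD image_set1 sup1. Qed.

(** The claim becomes A + M <= 2 (s + A). The smaller of the two distances to p is at most s, and
    the larger exceeds it by at most A. *)
Lemma punctured_umetric_le {R : realType} {n : nat} (D : set 'rV[R]_n) x y p :
  open D -> boundary D = [set p] -> D x -> D y ->
  umetric D x y <= 2 * tautilde D x y + 2 * ln 2.
Proof.
move=> oD bp Dx Dy; have bD : boundary D !=set0 by exists p; rewrite bp.
rewrite umetric_leD// mulrAC divff// mul1r lnK ?posrE//.
rewrite (tau_sup_boundary1 _ _ _ _ bp) /umetric_quot /tau_quot.
have s0 := sqrt_bdist_gt0 D oD bD x y Dx Dy.
have dx0 := bdist_gt0 D x oD bD Dx; have dy0 := bdist_gt0 D y oD bD Dy.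
move: s0 dx0 dy0.
rewrite !(bdist_boundary1 _ _ _ bp) [enorm (p - y)]enorm_sub_sym.
have xy := enorm_triangle y x p; have yx := enorm_triangle x y p.
rewrite [enorm (y - x)]enorm_sub_sym in yx.
set A := enorm (x - y) in xy yx *.
set a := enorm (x - p) in xy yx *; set b := enorm (y - p) in xy yx *.
set s := Num.sqrt _ => s0 a0 b0.
have A0 : 0 <= A by exact: enorm_ge0.
rewrite ler_pdivrMr// -[leRHS]mulrA [_ * s]mulrDl mul1r divfK ?gt_eqF//.
have [ab|ba] := leP a b.
  have : a <= s.
    rewrite -[a in X in X <= _](ger0_norm (ltW a0)) -sqrtr_sqr ler_wsqrtr//.
    by rewrite expr2 ler_pM2l.
  lra.
have : b <= s.
  rewrite -[b in X in X <= _](ger0_norm (ltW b0)) -sqrtr_sqr ler_wsqrtr//.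
  by rewrite expr2 ler_pM2r// ltW.
lra.
Qed.

(* Extremal pairs: x = p + s^2 e and y = p + e for a unit vector e, s -> oo. *)
Lemma punctured_constant_sharp {R : realType} {n : nat} (D : set 'rV[R]_n) p
    (c : R) :
  (0 < n)%N -> open D -> D = ~` [set p] -> boundary D = [set p] ->
  c < 2 * ln 2 ->
  exists x y, [/\ D x, D y & 2 * tautilde D x y + c < umetric D x y].
Proof.
move=> n0 oD DE bp c2; have bD : boundary D !=set0 by exists p; rewrite bp.
pose m := expR (c / 2).
have m2 : m < 2.
  rewrite -[ltRHS](@lnK R) ?posrE// ltr_expR ltr_pdivrMr// mulrC; lra.
have m0 : 0 < m by exact: expR_gt0.
pose e : 'rV[R]_n := delta_mx ord0 (Ordinal n0).
have e1 : enorm e = 1.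
  rewrite /enorm (bigD1 (Ordinal n0))//= big1 ?addr0 => [|i i0].
    by rewrite !mxE !eqxx expr1n sqrtr1.
  by rewrite !mxE (negbTE i0) andbF expr0n.
have De (t : R) : t != 0 -> D (p + t *: e).
  move=> t0; rewrite DE /= => pE.
  have /eqP : t *: e = 0 by apply: (addrI p); rewrite addr0.
  by rewrite -enorm_eq0 enormZ e1 mulr1 normr_eq0 (negbTE t0).
(* Here A = s^2 - 1, M = s^2 and the geometric mean is s, so the goal is m (s + s^2 - 1) < 2 s^2 -
   1. With (2 - m) s = 3 this reads (3 - m) s + m - 1 > 0, which follows from s > 1. *)
pose s := 3 / (2 - m).
have sE : (2 - m) * s = 3 by rewrite mulrC divfK// subr_eq0 gt_eqF.
have s1 : 1 < s by nra.
have s0 : 0 < s by lra.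
have Dx : D (p + s ^+ 2 *: e) by apply: De; rewrite expf_neq0// gt_eqF.
have Dy : D (p + 1 *: e) by apply: De; rewrite oner_eq0.
exists (p + s ^+ 2 *: e), (p + 1 *: e); split=> //.
rewrite ltNge umetric_leD// -/m -ltNge.
rewrite (tau_sup_boundary1 _ _ _ _ bp) /umetric_quot /tau_quot.
rewrite !(bdist_boundary1 _ _ _ bp) [enorm (p - _)]enorm_sub_sym.
have pt t : p + t *: e - p = t *: e by rewrite addrC addKr.
have -> : p + s ^+ 2 *: e - (p + 1 *: e) = (s ^+ 2 - 1) *: e.
  by rewrite opprD addrACA subrr add0r scalerBl.
have s21 : 1 <= s ^+ 2 by rewrite exprn_ege1// ltW.
rewrite !pt !enormZ e1 normr1 !mulr1 [`|s ^+ 2|]ger0_norm ?sqr_ge0//.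
rewrite sqrtr_sqr [`|s|]ger0_norm ?(ltW s0)// ger0_norm ?subr_ge0//.
rewrite max_l// ltr_pdivlMr// -[ltLHS]mulrA [_ * s]mulrDl mul1r divfK ?gt_eqF//.
nra.
Qed.

Theorem theorem4p1 (R : realType) (n : nat) (hn : (2 <= n)%N)
    (D : set 'rV[R]_n) (hD : domain D) (hDT : D `<` setT)
    (hbd : boundary D !=set0) :
  [/\ forall x y : 'rV[R]_n, D x -> D y ->
        2 * tautilde D x y <= umetric D x y /\
        ((exists p : 'rV[R]_n, [/\ boundary D p, bdist D x = enorm (x - p),
            enorm (x - p) = enorm (y - p) & enorm (y - p) = bdist D y]) ->
         2 * tautilde D x y = umetric D x y),
      ~ once_punctured D ->
        ~ (exists k : R, 0 <= k /\
             forall x y : 'rV[R]_n, D x -> D y ->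
               umetric D x y <= 2 * tautilde D x y + k)
    & once_punctured D ->
        (forall x y : 'rV[R]_n, D x -> D y ->
           umetric D x y <= 2 * tautilde D x y + 2 * ln 2) /\
        (forall c : R, c < 2 * ln 2 ->
           ~ (forall x y : 'rV[R]_n, D x -> D y ->
                umetric D x y <= 2 * tautilde D x y + c))].
Proof.
have [oD _] := hD; split.
- move=> x y Dx Dy; split; first exact: tautilde_le_umetric.
  by move=> [p [Dp dx xyp dy]]; exact: tautilde_eq_umetric Dp dx xyp dy.
- move=> np [k [k0 H]].
  have [p [q [Dp Dq pq]]] := two_boundary_points D hn oD hbd np.
  have [x [y [Dx Dy]]] := umetric_not_le_tautildeD D p q k oD Dp Dq pq k0.
  by rewrite ltNge H.
- move=> [p DE]; have bp := boundary_punctured D p oD hbd DE; split.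
    by move=> x y; exact: punctured_umetric_le bp.
  move=> c c2 H.
  have [x [y [Dx Dy]]] :=
    punctured_constant_sharp D p c (ltnW hn) oD DE bp c2.
  by rewrite ltNge H.
Qed.
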